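(* Under Assumption 1, let $(x^k)_{k\in\mathbb{N}}$ be generated by PPGA. If $F$ satisfies the KL property at every point of $\mathrm{dom}(F)$, then $\sum_{k=1}^\infty\|x^k-x^{k-1}\|_2<+\infty$ and $(x^k)$ converges to a stationary point of $F$.
   Context: Let $f:\mathbb{R}^n\to(-\infty,+\infty]$ be proper lsc, $g,h:\mathbb{R}^n\to\mathbb{R}$, $\Omega:=\{x:g(x)\ne0\}$, $F(x):=\frac{f(x)+h(x)}{g(x)}$ on $\Omega\cap\mathrm{dom}(f)$ and $+\infty$ otherwise. Assumption 1: (i) $f$ locally Lipschitz on $\mathrm{dom}(f)\cap\Omega$; (ii) $g$ locally Lipschitz continuously differentiable and positive on $\Omega\cap\mathrm{dom}(f)$; (iii) $\nabla h$ is $L$-Lipschitz, $L>0$; (iv) $f+h\ge0$ on $\mathrm{dom}(f)$, $\Omega\cap\mathrm{dom}(f)\ne\emptyset$; (v) $\mathrm{prox}_{f-\gamma g}(x)\ne\emptyset$ for all $x$, $\gamma\ge0$; (vi) $F$ lsc and level bounded. $\mathrm{prox}_\varphi(x):=\arg\min_u\{\varphi(u)+\frac12\|u-x\|_2^2\}$. Fréchet subdifferential $\hat\partial\varphi(x):=\{v:\liminf_{z\to x,z\ne x}\frac{\varphi(z)-\varphi(x)-\langle v,z-x\rangle}{\|z-x\|_2}\ge0\}$; limiting subdifferential $\partial\varphi(x):=\{v:\exists x^k\to x,\ \varphi(x^k)\to\varphi(x),\ v^k\in\hat\partial\varphi(x^k),\ v^k\to v\}$. A stationary point of $F$ is $x^\star$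 with $0\in\hat\partial F(x^\star)$. KL property: proper lsc $\varphi$ has the KL property at $\hat x\in\mathrm{dom}(\partial\varphi)$ if there exist $\eta\in(0,+\infty]$, a neighborhood $U$ of $\hat x$ and a continuous concave $\psi:[0,\eta)\to[0,+\infty)$ with $\psi(0)=0$, $\psi$ continuously differentiable on $(0,\eta)$ with $\psi'>0$, such that $\psi'(\varphi(x)-\varphi(\hat x))\,\mathrm{dist}(0,\partial\varphi(x))\ge1$ for all $x\in U$ with $\varphi(\hat x)<\varphi(x)<\varphi(\hat x)+\eta$. PPGA: choose $x^0\in\Omega\cap\mathrm{dom}(f)$ and $0<\underline\alpha\le\alpha_k\le\overline\alpha<1/L$; for $k=0,1,\dots$ set $C_k:=F(x^k)$ and pick any $x^{k+1}\in\mathrm{prox}_{\alpha_k(f-C_kg)}(x^k-\alpha_k\nabla h(x^k))$. *)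

(* Defs.v *)
From HB Require Import structures.
From mathcomp Require Import all_boot all_order all_algebra.
From mathcomp Require Import all_classical all_reals all_analysis.
Set Implicit Arguments. Unset Strict Implicit. Unset Printing Implicit Defensive.
Import Order.TTheory GRing.Theory Num.Theory.
Import numFieldNormedType.Exports.
Local Open Scope classical_set_scope.
Local Open Scope ring_scope.

Section Defs.
Variables (R : realType) (n : nat).
Notation vec := 'rV[R]_n.

Definition dotp (x y : vec) : R := \sum_(i < n) x ord0 i * y ord0 i.
Definition enorm (x : vec) : R := Num.sqrt (dotp x x).

Definition vconv (xs : nat -> vec) (x : vec) : Prop :=
  (fun k => enorm (xs k - x)) @ \oo --> 0.

Definition dom_fn (phi : vec -> \bar R) : set vec := [set x | (phi x < +oo)%E].

Definition proper_fn (phi : vec -> \bar R) : Prop :=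
  (forall x, phi x != -oo%E) /\ exists x, (phi x < +oo)%E.

Definition lsc_fn (phi : vec -> \bar R) : Prop :=
  forall x (t : R), (t%:E < phi x)%E ->
    exists2 d : R, 0 < d & forall z, enorm (z - x) < d -> (t%:E < phi z)%E.

Definition level_bounded (phi : vec -> \bar R) : Prop :=
  forall a : R, exists M : R, forall x, (phi x <= a%:E)%E -> enorm x <= M.

Definition loc_lipschitz_on (S : set vec) (f : vec -> R) : Prop :=
  forall x, S x -> exists2 d : R, 0 < d & exists K : R,
    forall y z, S y -> S z -> enorm (y - x) < d -> enorm (z - x) < d ->
      `|f y - f z| <= K * enorm (y - z).

Definition is_gradient (g : vec -> R) (x v : vec) : Prop :=
  forall e : R, 0 < e -> exists2 d : R, 0 < d & forall z,
    enorm (z - x) < d -> `|g z - g x - dotp v (z - x)| <= e * enorm (z - x).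

Definition loc_lip_C1_on (S : set vec) (g : vec -> R) (dg : vec -> vec) : Prop :=
  forall x, S x -> exists2 d : R, 0 < d & exists K : R,
    (forall y, enorm (y - x) < d -> is_gradient g y (dg y)) /\
    (forall y z, enorm (y - x) < d -> enorm (z - x) < d ->
       enorm (dg y - dg z) <= K * enorm (y - z)).

Definition lipschitz_with (L : R) (dh : vec -> vec) : Prop :=
  forall x y, enorm (dh x - dh y) <= L * enorm (x - y).

Definition prox (phi : vec -> \bar R) (x : vec) : set vec :=
  [set u | forall v, (phi u + (enorm (u - x) ^+ 2 / 2)%:E
                      <= phi v + (enorm (v - x) ^+ 2 / 2)%:E)%E].

Definition fsubdiff (phi : vec -> \bar R) (x : vec) : set vec :=
  [set v | exists a : R, phi x = a%:E /\
     forall e : R, 0 < e -> exists2 d : R, 0 < d & forall z,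
       0 < enorm (z - x) < d ->
       ((a + dotp v (z - x) - e * enorm (z - x))%:E <= phi z)%E].

Definition lsubdiff (phi : vec -> \bar R) (x : vec) : set vec :=
  [set v | exists xs vs : nat -> vec,
     [/\ vconv xs x, ((fun k => phi (xs k)) @ \oo --> phi x),
         forall k, fsubdiff phi (xs k) (vs k) & vconv vs v]].

(* dist(0, dphi(x)), = +oo when the subdifferential is empty *)
Definition dist0_subdiff (phi : vec -> \bar R) (x : vec) : \bar R :=
  ereal_inf [set (enorm v)%:E | v in lsubdiff phi x].

Definition desing (eta : \bar R) (psi : R -> R) : Prop :=
  let I := [set t : R | 0 <= t /\ (t%:E < eta)%E] in
  let J := [set t : R | 0 < t /\ (t%:E < eta)%E] in
  [/\ {within I, continuous psi},
      (forall a b (t : R), I a -> I b -> 0 <= t <= 1 ->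
          t * psi a + (1 - t) * psi b <= psi (t * a + (1 - t) * b)),
      (forall t, I t -> 0 <= psi t) /\ psi 0 = 0,
      (forall t, J t -> derivable psi t 1 /\ {for t, continuous (derive1 psi)}) &
      (forall t, J t -> 0 < derive1 psi t)].

Definition KL_at (phi : vec -> \bar R) (xh : vec) : Prop :=
  (exists v, lsubdiff phi xh v) /\
  exists eta : \bar R, (0 < eta)%E /\
  exists2 d : R, 0 < d & exists psi : R -> R, desing eta psi /\
    forall x, enorm (x - xh) < d ->
      (phi xh < phi x)%E -> (phi x < phi xh + eta)%E ->
      (1 <= (derive1 psi (fine (phi x - phi xh)))%:E * dist0_subdiff phi x)%E.

Definition Fobj (f : vec -> \bar R) (g h : vec -> R) (x : vec) : \bar R :=
  if (g x != 0) && (f x < +oo)%E then ((f x + (h x)%:E) * ((g x)^-1)%:E)%E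
  else +oo%E.

Definition stationary (phi : vec -> \bar R) (x : vec) : Prop :=
  fsubdiff phi x 0.

End Defs.

(* Main.v *)
Require Import Defs.
From HB Require Import structures.
From mathcomp Require Import all_boot all_order all_algebra.
From mathcomp Require Import all_classical all_reals all_analysis.
From mathcomp Require Import ring lra.
Import Order.TTheory GRing.Theory Num.Theory.
Import numFieldNormedType.Exports.
Local Open Scope classical_set_scope.
Local Open Scope ring_scope.

Set Implicit Arguments.
Unset Strict Implicit.
Unset Printing Implicit Defensive.

(** Write C_k = F(x^k) and D_k = |x^(k+1) - x^k|.  The proximal inequality and
    the descent lemma for h give a D_k^2 <= C_k - C_(k+1), the constants being
    uniform because the iterates stay in the compact sublevel set {F <= C_0},
    on which g is bounded away from 0.  The optimality condition of the proximal
    step gives w_k in the Frechet subdifferential of F at x^(k+1) with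
    |w_k| <= b D_k + c (C_k - C_(k+1)).  With C* = lim C_k, the KL inequality at a
    cluster point p, the concavity of psi and the AM-GM inequality turn these two
    bounds into D_(k+1) <= V_k - V_(k+1) as long as x^(k+1) is close to p, where
    V_k = D_k + (c/b)(C_k - C* ) + (b/a) psi(C_(k+1) - C* ) tends to 0.  Hence the
    iterates cannot leave a small ball around p once they are deep inside it,
    and the sum of the D_k telescopes. *)

(** * Euclidean norm, cluster points and sequential compactness *)

Section Euclid.
Variables (R : realType) (n : nat).
Implicit Types x y z : 'rV[R]_n.

Lemma dotpC x y : dotp x y = dotp y x.
Proof. by apply: eq_bigr => i _; rewrite mulrC. Qed.

Lemma dotpDl x y z : dotp (x + y) z = dotp x z + dotp y z.
Proof. by rewrite -big_split; apply: eq_bigr => i _; rewrite mxE mulrDl. Qed.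

Lemma dotpZl (a : R) x y : dotp (a *: x) y = a * dotp x y.
Proof. by rewrite mulr_sumr; apply: eq_bigr => i _; rewrite mxE mulrA. Qed.

Lemma dotpNl x y : dotp (- x) y = - dotp x y.
Proof. by rewrite -scaleN1r dotpZl mulN1r. Qed.

Lemma dotpDr x y z : dotp x (y + z) = dotp x y + dotp x z.
Proof. by rewrite dotpC dotpDl !(dotpC x). Qed.

Lemma dotpZr (a : R) x y : dotp x (a *: y) = a * dotp x y.
Proof. by rewrite dotpC dotpZl (dotpC x). Qed.

Lemma dotpNr x y : dotp x (- y) = - dotp x y.
Proof. by rewrite dotpC dotpNl (dotpC x). Qed.

Lemma dotp0l x : dotp 0 x = 0.
Proof. by rewrite -(scale0r 0) dotpZl mul0r. Qed.

Lemma dotp0r x : dotp x 0 = 0.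
Proof. by rewrite dotpC dotp0l. Qed.

Definition dotpE := (dotpDl, dotpDr, dotpNl, dotpNr, dotpZl, dotpZr).

Lemma dotp_ge0 x : 0 <= dotp x x.
Proof. by apply: sumr_ge0 => i _; rewrite -expr2 sqr_ge0. Qed.

Lemma enorm_ge0 x : 0 <= enorm x.
Proof. exact: sqrtr_ge0. Qed.

Lemma enorm_sqr x : enorm x ^+ 2 = dotp x x.
Proof. by rewrite sqr_sqrtr// dotp_ge0. Qed.

Lemma enorm0 : enorm (0 : 'rV[R]_n) = 0.
Proof. by rewrite /enorm dotp0l sqrtr0. Qed.

Lemma enorm0_eq0 x : enorm x = 0 -> x = 0.
Proof.
move=> x0; have /eqP := enorm_sqr x; rewrite x0 expr0n /= eq_sym psumr_eq0.
  move=> /allP x00; apply/rowP => i; rewrite mxE; apply/eqP.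
  have := x00 i; rewrite mem_index_enum => /(_ isT) /=.
  by rewrite ord1 mulf_eq0 orbb.
by move=> i _; rewrite -expr2 sqr_ge0.
Qed.

Lemma enormZ (a : R) x : enorm (a *: x) = `|a| * enorm x.
Proof.
by rewrite /enorm !dotpE mulrA -expr2 sqrtrM ?sqr_ge0// sqrtr_sqr.
Qed.

Lemma enormN x : enorm (- x) = enorm x.
Proof. by rewrite -scaleN1r enormZ normrN1 mul1r. Qed.

(** Cauchy-Schwarz: the squared norm of |y| x - |x| y equals 2 |x| |y| (|x| |y| - <x, y>). *)
Lemma dotp_le x y : dotp x y <= enorm x * enorm y.
Proof.
have [/enorm0_eq0->|x0] := eqVneq (enorm x) 0.
  by rewrite dotp0l enorm0 mul0r.
have [/enorm0_eq0->|y0] := eqVneq (enorm y) 0.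
  by rewrite dotp0r enorm0 mulr0.
have := dotp_ge0 (enorm y *: x - enorm x *: y).
rewrite !dotpE (dotpC y x) -!enorm_sqr => H.
have xp : 0 < enorm x by rewrite lt_neqAle eq_sym x0 enorm_ge0.
have yp : 0 < enorm y by rewrite lt_neqAle eq_sym y0 enorm_ge0.
rewrite -(ler_pM2l (mulr_gt0 xp yp)); lra.
Qed.

Lemma ler_dotp x y : `|dotp x y| <= enorm x * enorm y.
Proof.
by rewrite ler_norml dotp_le andbT lerNl -dotpNl -(enormN x) dotp_le.
Qed.

Lemma enormD x y : enorm (x + y) <= enorm x + enorm y.
Proof.
rewrite -(@ler_pXn2r _ 2)// ?nnegrE ?addr_ge0 ?enorm_ge0//.
rewrite enorm_sqr !dotpE (dotpC y x) sqrrD !enorm_sqr.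
have := dotp_le x y; lra.
Qed.

Lemma enorm_triangle x y z : enorm (x - z) <= enorm (x - y) + enorm (y - z).
Proof. by rewrite -(subrKA y) enormD. Qed.

Lemma enorm_coord_le (e : R) x : 0 <= e -> (forall i, `|x ord0 i| <= e) ->
  enorm x <= n%:R * e.
Proof.
move=> e0 xe; rewrite -(@ler_pXn2r _ 2)// ?nnegrE ?mulr_ge0 ?enorm_ge0//.
rewrite enorm_sqr /dotp; apply: (@le_trans _ _ (\sum_(i < n) e ^+ 2)).
  by apply: ler_sum => i _; rewrite -expr2 -real_normK ?num_real// lerXn2r.
rewrite sumr_const card_ord exprMn -[leLHS]mulr_natl.
rewrite ler_wpM2r ?sqr_ge0// -natrX ler_nat.
by case: (n) => // k; rewrite leq_pmulr.
Qed.

Lemma coord_le_enorm x i : `|x ord0 i| <= enorm x.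
Proof.
rewrite -(@ler_pXn2r _ 2)// ?nnegrE ?enorm_ge0//.
rewrite enorm_sqr real_normK ?num_real// /dotp (bigD1 i)//= -expr2 lerDl.
by apply: sumr_ge0 => j _; rewrite -expr2 sqr_ge0.
Qed.

Definition cluster_pt (xs : nat -> 'rV[R]_n) (p : 'rV[R]_n) :=
  forall e : R, 0 < e -> forall N, exists2 k, (N <= k)%N & enorm (xs k - p) < e.

(** Bolzano-Weierstrass in the compact box [-M, M]^n. Balls there are those of the sup norm, so the
    radius e / (n + 1) is used; the successor also covers n = 0. *)
Lemma bounded_cluster_pt (xs : nat -> 'rV[R]_n) (M : R) :
  (forall k, enorm (xs k) <= M) -> exists p, cluster_pt xs p.
Proof.
move=> xM.
have := @rV_compact R n (fun=> `[- M, M]%classic) (fun=> @segment_compact _ _ _).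
move=> /(_ (xs @ \oo) _) [].
  exists 0%N => // k _ i /=; rewrite in_itv /= -ler_norml.
  exact: (le_trans (coord_le_enorm (xs k) i) (xM k)).
move=> p [_ pcl]; exists p => e e0 N.
have e10 : 0 < e / n.+1%:R by rewrite divr_gt0.
have := pcl [set xs k | k in [set k | (N <= k)%N]] (ball p (e / n.+1%:R)).
move=> [].
- by exists N => // k /= Nk; exists k.
- exact: nbhsx_ballx.
- move=> _ [[k /= Nk <-]] pk; exists k => //.
  apply: (@le_lt_trans _ _ (n%:R * (e / n.+1%:R))).
    apply: enorm_coord_le; first exact: ltW.
    move=> i; by rewrite !mxE distrC ltW//; exact: pk.2 ord0 i.
  by rewrite mulrCA gtr_pMr// ltr_pdivrMr// mul1r ltr_nat.
Qed.

(** Compactness argument: points with phi > m + 1 for every m would cluster at some p in S, against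
    the local bound at p. *)
Lemma loc_bounded_above (S : set 'rV[R]_n) (phi : 'rV[R]_n -> R) (M : R) :
  (forall y, S y -> enorm y <= M) ->
  (forall xs p, (forall k, S (xs k)) -> cluster_pt xs p -> S p) ->
  (forall p, S p -> exists2 d : R, 0 < d & exists B : R,
     forall y, S y -> enorm (y - p) < d -> phi y <= B) ->
  exists2 B : R, 0 < B & forall y, S y -> phi y <= B.
Proof.
move=> Sb Scl phib; apply: contrapT => nB.
have /choice[xs xsP] : forall m : nat, exists y, S y /\ m.+1%:R < phi y.
  move=> m; apply: contrapT => nex; apply: nB; exists m.+1%:R => // y Sy.
  by rewrite leNgt; apply/negP => ?; apply: nex; exists y.
have [p pcl] := bounded_cluster_pt (fun k => Sb _ (xsP k).1).
have [d d0 [B dB]] := phib _ (Scl _ _ (fun k => (xsP k).1) pcl).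
have [k Nk kd] := pcl _ d0 (Num.bound `|B|).
have := dB _ (xsP k).1 kd; apply/negP; rewrite -ltNge.
apply: lt_trans (xsP k).2; apply: (@lt_trans _ _ (Num.bound `|B|)%:R).
  by apply: le_lt_trans (ler_norm _) (archi_boundP (normr_ge0 _)).
by rewrite ltr_nat.
Qed.

End Euclid.

(** * Derivatives on the real line and slopes of concave functions *)

Section RealDeriv.
Variable R : realType.
Implicit Types (f : R -> R) (x l s t : R).

Lemma is_derive_eps f x l :
  (forall e : R, 0 < e -> exists2 d : R, 0 < d & forall k : R, `|k| < d ->
     `|f (x + k) - f x - l * k| <= e * `|k|) ->
  is_derive x 1 f l.
Proof.
move=> H.
have cv : (fun k => k^-1 *: ((f \o shift x) (k *: (1 : R)) - f x)) @ 0^' --> l.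
  apply/cvgrPdist_le => e e0; have [d d0 dH] := H _ e0.
  exists d => //= k /=; rewrite sub0r normrN => kd k0.
  have kp : 0 < `|k| by rewrite normr_gt0.
  rewrite -(ler_pM2r kp) -normrM; apply: le_trans (dH _ kd).
  rewrite -normrN /GRing.scale /= mulr1 (addrC k) le_eqVlt; apply/orP; left.
  by apply/eqP; congr (`|_|); field.
by apply: DeriveDef; [apply/cvg_ex; exists l|apply/cvg_lim].
Qed.

Lemma derivable_eps f x : derivable f x 1 ->
  forall e : R, 0 < e -> exists2 d : R, 0 < d & forall k : R, `|k| < d ->
     `|f (x + k) - f x - derive1 f x * k| <= e * `|k|.
Proof.
move=> df e e0.
have : (fun k => k^-1 *: ((f \o shift x) (k *: (1 : R)) - f x)) @ 0^' -->
  derive1 f x by rewrite derive1E; exact: df.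
move=> /cvgrPdist_le /(_ _ e0) [d /= d0 dH]; exists d => // k kd.
have [->|k0] := eqVneq k 0; first by rewrite addr0 subrr mulr0 subr0 normr0 mulr0.
have := dH k; rewrite /= sub0r normrN => /(_ kd k0).
have kp : 0 < `|k| by rewrite normr_gt0.
rewrite -(ler_pM2r kp) -normrM; apply: le_trans.
rewrite -normrN /GRing.scale /= mulr1 (addrC k) le_eqVlt; apply/orP; left.
by apply/eqP; congr (`|_|); field.
Qed.

(** If the inequality failed by e > 0, concavity would put f at s + a (t - s) at least a e above the
    tangent at s, while the first-order expansion allows only a e / 2 for small a. Differentiability
    is required at s alone, so that t may be 0 when f is [psi]. *)
Lemma concave_slope f s t : derivable f s 1 ->
  (forall a : R, 0 <= a <= 1 -> a * f t + (1 - a) * f s <= f (a * t + (1 - a) * s)) ->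
  derive1 f s * (s - t) <= f s - f t.
Proof.
move=> ds cf; have [->|ts] := eqVneq t s; first by rewrite !subrr mulr0.
rewrite leNgt; apply/negP => lt0.
set e := derive1 f s * (s - t) - (f s - f t).
have e0 : 0 < e by rewrite subr_gt0.
have u0 : 0 < `|t - s| by rewrite normr_gt0 subr_eq0.
have u20 : 0 < 2 * `|t - s| by rewrite mulr_gt0.
have [d d0 dH] := derivable_eps ds (divr_gt0 e0 u20).
(* The second bound puts s + a (t - s) within d / 2 of s, where the expansion holds. *)
pose a := Num.min 1 (d / (2 * `|t - s|)).
have a0 : 0 < a by rewrite lt_min ltr01 divr_gt0// mulr_gt0.
have a1 : a <= 1 by rewrite ge_min lexx.
have ad : `|a * (t - s)| < d.
  rewrite normrM (gtr0_norm a0); apply: (@le_lt_trans _ _ (d / 2)).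
    rewrite -ler_pdivlMr//; apply: (@le_trans _ _ (d / (2 * `|t - s|))).
      by rewrite ge_min lexx orbT.
    by rewrite invfM mulrA.
  by rewrite ltr_pdivrMr// ltr_pMr// ltr1n.
have := dH _ ad; rewrite normrM (gtr0_norm a0) ler_norml => /andP[_].
have -> : e / (2 * `|t - s|) * (a * `|t - s|) = a * e / 2.
  by field; rewrite gt_eqF.
have := cf a; rewrite (ltW a0) a1 => /(_ isT).
have -> : a * t + (1 - a) * s = s + a * (t - s) by ring.
have : 0 < a * e by rewrite mulr_gt0.
rewrite /e; nra.
Qed.

End RealDeriv.

(** * The descent lemma for a function with Lipschitz gradient *)

Section Descent.
Variables (R : realType) (n : nat).
Implicit Types (h : 'rV[R]_n -> R) (x y : 'rV[R]_n).

Lemma is_gradient_line h (dh : 'rV[R]_n -> 'rV[R]_n) x s (t A B : R) :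
  is_gradient h (x + t *: s) (dh (x + t *: s)) ->
  is_derive t 1 (fun t => h (x + t *: s) - t * A - t ^+ 2 * B)
    (dotp (dh (x + t *: s)) s - A - 2 * t * B).
Proof.
move=> gh; apply: is_derive_eps => e e0.
have s1 : 0 < enorm s + 1 by rewrite ltr_wpDl ?enorm_ge0.
have B1 : 0 < `|B| + 1 by rewrite ltr_wpDl.
have e2 : 0 < e / 2 by rewrite divr_gt0.
have [d d0 dH] := gh _ (divr_gt0 e2 s1).
exists (Num.min (d / (enorm s + 1)) (e / 2 / (`|B| + 1))).
  by rewrite lt_min !divr_gt0.
move=> k; rewrite lt_min => /andP[kd ke].
have zE : x + (t + k) *: s - (x + t *: s) = k *: s.
  by rewrite scalerDl opprD addrACA subrr add0r addrAC subrr add0r.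
have := dH (x + (t + k) *: s); rewrite zE enormZ dotpZr => H.
have kdd : `|k| * enorm s < d.
  move: kd; rewrite ltr_pdivlMr//; apply: le_lt_trans.
  by rewrite ler_wpM2l// lerDl.
have {}H := H kdd.
have H1 : e / 2 / (enorm s + 1) * (`|k| * enorm s) <= e / 2 * `|k|.
  rewrite -mulrA ler_pM2l// mulrC ler_pdivrMr// ler_wpM2l// lerDl.
  exact: ler01.
have H2 : `|k ^+ 2 * B| <= e / 2 * `|k|.
  rewrite normrM normrX expr2 -(mulrA `|k|) (mulrC (e / 2)) ler_wpM2l//.
  move: ke; rewrite ltr_pdivlMr// => /ltW; apply: le_trans.
  by rewrite ler_wpM2l// lerDl ler01.
set D := dotp _ _ in H *; set P := h _ in H *; set Q := h _ in H *.
have -> : P - (t + k) * A - (t + k) ^+ 2 * B - (Q - t * A - t ^+ 2 * B) -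
  (D - A - 2 * t * B) * k = (P - Q - k * D) - k ^+ 2 * B by ring.
apply: le_trans (ler_normB _ _) _.
have := le_trans H H1; lra.
Qed.

(** The mean value theorem takes the place of the usual integral: phi 1 - phi 0 is the derivative of
    phi at some c, which is <dh(x + c s) - dh x, s> - c L |s|^2 <= 0. *)
Lemma descent h (dh : 'rV[R]_n -> 'rV[R]_n) (L : R) x y :
  (forall y, is_gradient h y (dh y)) -> lipschitz_with L dh ->
  h y <= h x + dotp (dh x) (y - x) + L / 2 * enorm (y - x) ^+ 2.
Proof.
move=> gh Lh; have : x + (y - x) = y by rewrite addrC subrK.
move: (y - x) => s xs.
pose A := dotp (dh x) s; pose B := L / 2 * enorm s ^+ 2.
pose phi t := h (x + t *: s) - t * A - t ^+ 2 * B.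
pose dphi t := dotp (dh (x + t *: s)) s - A - 2 * t * B.
have dphiP (t : R) : is_derive t 1 phi (dphi t) by exact: is_gradient_line.
have cphi : {within `[0, 1], continuous phi}.
  by apply: derivable_within_continuous => t _; have [] := dphiP t.
have [c c01] := MVT ltr01 (fun t _ => dphiP t) cphi.
rewrite subr0 mulr1 /phi expr1n expr0n /= !mul0r !subr0 !mul1r scale0r addr0.
rewrite scale1r xs => E.
have c0 : 0 < c by move: c01; rewrite in_itv /= => /andP[].
have : dphi c <= 0.
  have := dotp_le (dh (x + c *: s) - dh x) s.
  have := Lh (x + c *: s) x; rewrite addrAC subrr add0r enormZ gtr0_norm//.
  move=> /(ler_wpM2r (enorm_ge0 s)).
  by rewrite /dphi /B /A !dotpE expr2; lra.
rewrite -E /B /A; lra.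
Qed.

End Descent.

(** * The quotient objective and its Frechet subgradients *)

Section Objective.
Variables (R : realType) (n : nat).
Variables (f : 'rV[R]_n -> \bar R) (g h : 'rV[R]_n -> R).
Implicit Types u v w y z : 'rV[R]_n.

(** The denominator k + 1 avoids a case distinction on k = 0 when a tolerance is divided by a factor
    that may vanish. *)
Lemma mul_div_succ_le (a k : R) : 0 <= a -> 0 <= k -> k * (a / (k + 1)) <= a.
Proof.
move=> a0 k0; have k1 : 0 < k + 1 by rewrite ltr_wpDl.
by rewrite mulrA ler_pdivrMr// mulrC ler_wpM2l// lerDl.
Qed.

Lemma is_gradient_continuous (phi : 'rV[R]_n -> R) y v (e : R) :
  is_gradient phi y v -> 0 < e ->
  exists2 d : R, 0 < d & forall z, enorm (z - y) < d -> `|phi z - phi y| < e.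
Proof.
move=> gphi e0; have [d d0 dH] := gphi 1 ltr01.
have v1 : 0 < enorm v + 1 by rewrite ltr_wpDl ?enorm_ge0.
exists (Num.min d (e / (enorm v + 1))); first by rewrite lt_min d0 divr_gt0.
move=> z; rewrite lt_min ltr_pdivlMr// => /andP[/dH + ze].
have := ler_dotp v (z - y); rewrite mul1r !ler_norml ltr_norml.
by move=> /andP[? ?] /andP[? ?]; apply/andP; split; nra.
Qed.

(** Real-valued form of F, meaningful only where f is finite and g is nonzero; elsewhere [fine] and
    the division return default values. *)
Definition Fr y : R := (fine (f y) + h y) / g y.

Lemma Fobj_fin y : f y != -oo%E -> (f y < +oo)%E -> g y != 0 ->
  Fobj f g h y = (Fr y)%:E.
Proof.
by rewrite /Fobj /Fr => fN fP -> /=; rewrite fP; case: (f y) fN fP.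
Qed.

(* Since [0] is a Frechet subgradient of a function at a minimiser, this is the
   quotient rule applied at a point minimising
   [f - C g + <v, . - y> + tau |. - y|^2]. *)
Lemma fsubdiff_Fobj y v (Dg Dh : 'rV[R]_n) (C tau : R) :
  (forall u, f u != -oo%E) -> (f y < +oo)%E -> 0 < g y ->
  is_gradient g y Dg -> is_gradient h y Dh -> 0 <= tau ->
  (forall u, (f u < +oo)%E -> fine (f y) - C * g y <=
     fine (f u) - C * g u + dotp v (u - y) + tau * enorm (u - y) ^+ 2) ->
  fsubdiff (Fobj f g h) y ((g y)^-1 *: (Dh - v + (C - Fr y) *: Dg)).
Proof.
move=> fN fy G0 gDg hDh tau0 ymin.
set w := _ *: _; exists (Fr y); split; first by rewrite Fobj_fin// gt_eqF.
move=> e e0.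
have eG : 0 < e * g y / 8 by rewrite divr_gt0// mulr_gt0.
have K1 : 0 < `|C - Fr y| + 1 by rewrite ltr_wpDl.
have W1 : 0 < enorm w + 1 by rewrite ltr_wpDl ?enorm_ge0.
have t1 : 0 < tau + 1 by rewrite ltr_wpDl.
have [d1 d10 d1H] := gDg _ (divr_gt0 eG K1).
have [d2 d20 d2H] := hDh _ eG.
have [d3 d30 d3H] := is_gradient_continuous gDg (divr_gt0 eG W1).
have [d4 d40 d4H] := is_gradient_continuous gDg (divr_gt0 G0 (ltr0Sn _ 1)).
(* Four errors, namely the remainders of g and h, the variation of g against w, and the quadratic
   term, will each be at most e g(y) |u - y| / 8. Their sum is at most e g(u) |u - y|, since [d4]
   ensures g(u) >= g(y) / 2. *)
exists (Num.min (Num.min d1 d2) (Num.min (Num.min d3 d4) (e * g y / 8 / (tau + 1)))).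
  by rewrite !lt_min d10 d20 d30 d40 divr_gt0.
move=> u; rewrite !lt_min.
move=> /andP[r0] /andP[/andP[/d1H H1 /d2H H2]] /andP[/andP[/d3H H3 /d4H H4] H5].
have gu : g y / 2 <= g u by move: H4; rewrite ltr_norml => /andP[? _]; lra.
have gu0 : 0 < g u by apply: lt_le_trans gu; rewrite divr_gt0.
rewrite /Fobj gt_eqF//=; case: ifPn => [fu|_]; last by rewrite leey.
have fuE : f u = (fine (f u))%:E by move: (fN u) fu; case: (f u).
rewrite fuE -EFinD -EFinM lee_fin ler_pdivlMr//.
have {}ymin := ymin _ fu.
have fyE : fine (f y) = Fr y * g y - h y.
  by rewrite /Fr divfK ?gt_eqF// addrK.
have wE : g y * dotp w (u - y) =
    dotp Dh (u - y) - dotp v (u - y) + (C - Fr y) * dotp Dg (u - y).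
  by rewrite /w dotpZl mulrA divff ?gt_eqF// mul1r !dotpE.
have B1 : - (e * g y / 8 * enorm (u - y)) <=
    (C - Fr y) * (g u - g y - dotp Dg (u - y)).
  have: `|(C - Fr y) * (g u - g y - dotp Dg (u - y))| <= e * g y / 8 * enorm (u - y).
    rewrite normrM; apply: le_trans (ler_wpM2l (normr_ge0 _) H1) _.
    by rewrite mulrA ler_wpM2r ?enorm_ge0// mul_div_succ_le// ltW.
  by rewrite ler_norml => /andP[].
have B2 : - (e * g y / 8 * enorm (u - y)) <= (g y - g u) * dotp w (u - y).
  have : `|(g y - g u) * dotp w (u - y)| <= e * g y / 8 * enorm (u - y).
    rewrite normrM distrC.
    apply: le_trans (ler_wpM2l (normr_ge0 _) (ler_dotp _ _)) _.
    rewrite mulrA ler_wpM2r ?enorm_ge0//.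
    move: H3; rewrite ltr_pdivlMr// => /ltW; apply: le_trans.
    by rewrite ler_wpM2l// lerDl ler01.
  by rewrite ler_norml => /andP[].
have B3 : tau * enorm (u - y) ^+ 2 <= e * g y / 8 * enorm (u - y).
  rewrite expr2 mulrA ler_wpM2r ?enorm_ge0//.
  move: H5; rewrite ltr_pdivlMr// => /ltW; apply: le_trans.
  by rewrite mulrC ler_wpM2l ?enorm_ge0// lerDl ler01.
have B4 : - (e * g y / 8 * enorm (u - y)) <= h u - h y - dotp Dh (u - y).
  by move: H2; rewrite ler_norml => /andP[].
have B5 : e * (g y / 2) * enorm (u - y) <= e * g u * enorm (u - y).
  by rewrite ler_wpM2r ?enorm_ge0// ler_pM2l.
move: ymin wE B1 B2 B3 B4 B5; rewrite fyE.
move: (dotp w _) (dotp v _) (dotp Dg _) (dotp Dh _) => dw dv ddg ddh.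
move: (enorm _) => r; lra.
Qed.

End Objective.

(** * Convergence of real and vector sequences, and the trapping argument *)

Section Sequences.
Variable R : realType.

Lemma cvg_dist_le (u e : nat -> R) (l : R) :
  (forall k, `|u k - l| <= e k) -> e @ \oo --> 0 -> u @ \oo --> l.
Proof.
move=> ue /cvgrPdist_lt e0; apply/cvgrPdist_lt => eps eps0.
have [N _ NP] := e0 _ eps0; exists N => // k Nk /=.
rewrite distrC; apply: le_lt_trans (ue k) _.
by have := NP k Nk; rewrite /= sub0r normrN; apply: le_lt_trans; exact: ler_norm.
Qed.

Lemma cvg0_le (u e : nat -> R) :
  (forall k, 0 <= u k <= e k) -> e @ \oo --> 0 -> u @ \oo --> 0.
Proof.
move=> ue; apply: cvg_dist_le => k.
by have /andP[u0 ?] := ue k; rewrite subr0 ger0_norm.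
Qed.

Lemma cvg_eventually (u : nat -> R) (l e : R) : u @ \oo --> l -> 0 < e ->
  exists N, forall k, (N <= k)%N -> `|u k - l| < e.
Proof.
move=> /cvgrPdist_lt ul e0; have [N _ NP] := ul _ e0; exists N => k Nk.
by rewrite distrC; exact: NP.
Qed.

Lemma cvg_subseq_ge (T : topologicalType) (u : nat -> T) (l : T)
  (s : nat -> nat) : (forall k, (k <= s k)%N) -> u @ \oo --> l ->
  (u \o s) @ \oo --> l.
Proof.
move=> sk ul; apply: cvg_comp ul => A [N _ NA]; exists N => // k /= Nk.
by apply: NA => /=; exact: leq_trans Nk (sk k).
Qed.

Lemma cvg_sqr0 (u : nat -> R) : (forall k, 0 <= u k) ->
  (fun k => u k ^+ 2) @ \oo --> 0 -> u @ \oo --> 0.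
Proof.
move=> u0 u2; have -> : u = @Num.sqrt R \o (fun k => u k ^+ 2).
  by apply/funext => k /=; rewrite sqrtr_sqr ger0_norm.
by rewrite -[X in _ --> X]sqrtr0; apply: cvg_comp u2 _; exact: sqrt_continuous.
Qed.

(** For D > 0, take roots in 4 D^2 <= 4 X Y = (X + Y)^2 - (X - Y)^2 <= (X + Y)^2. *)
Lemma amgm_sqr (X Y D : R) : 0 <= X -> 0 <= Y -> D ^+ 2 <= X * Y ->
  2 * D <= X + Y.
Proof.
move=> X0 Y0 DXY; have [D0|D0] := leP D 0.
  by have := addr_ge0 X0 Y0; lra.
rewrite -(@ler_pXn2r _ 2)// ?nnegrE ?addr_ge0//; last first.
  by rewrite mulr_ge0// ltW.
by have := sqr_ge0 (X - Y); nra.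
Qed.

Variable n : nat.
Implicit Types (x y a b : nat -> 'rV[R]_n) (A B p : 'rV[R]_n).

Lemma vconv_dotp a b A B : vconv a A -> vconv b B ->
  (fun k => dotp (a k) (b k)) @ \oo --> dotp A B.
Proof.
move=> aA bB; apply: (@cvg_dist_le _ (fun k =>
  enorm (a k - A) * enorm (b k - B) + enorm A * enorm (b k - B) +
  enorm (a k - A) * enorm B)).
  move=> k; have -> : dotp (a k) (b k) - dotp A B =
    dotp (a k - A) (b k - B) + dotp A (b k - B) + dotp (a k - A) B.
    by rewrite !dotpE; ring.
  apply: le_trans (ler_normD _ _) _; apply: lerD (ler_dotp _ _).
  apply: le_trans (ler_normD _ _) _; exact: lerD (ler_dotp _ _) (ler_dotp _ _).
rewrite [X in _ --> X](_ : 0 = 0 * 0 + enorm A * 0 + 0 * enorm B); last by ring.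
by apply: cvgD; [apply: cvgD; apply: cvgM|apply: cvgM] => //; exact: cvg_cst.
Qed.

Lemma vconv_cst A : vconv (fun=> A) A.
Proof.
by rewrite /vconv (_ : (fun _ => _) = fun=> 0) ?subrr ?enorm0//; exact: cvg_cst.
Qed.

Lemma vconvB a b A B : vconv a A -> vconv b B ->
  vconv (fun k => a k - b k) (A - B).
Proof.
move=> aA bB; apply: (@cvg0_le _ (fun k => enorm (a k - A) + enorm (b k - B))).
  move=> k; rewrite enorm_ge0 /= (_ : _ - _ = (a k - A) - (b k - B)).
    by apply: le_trans (enormD _ _) _; rewrite enormN.
  by rewrite opprD addrACA -opprD.
by rewrite -[X in _ --> X](addr0 0); exact: cvgD.
Qed.

Lemma vconv_gradient (phi : 'rV[R]_n -> R) a A v :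
  is_gradient phi A v -> vconv a A -> (phi \o a) @ \oo --> phi A.
Proof.
move=> gphi aA; apply/cvgrPdist_lt => e e0.
have [d d0 dH] := is_gradient_continuous gphi e0.
have [N NH] := cvg_eventually aA d0; exists N => // k Nk /=; rewrite distrC.
by apply: dH; have := NH k Nk; rewrite subr0 ger0_norm ?enorm_ge0.
Qed.

Lemma vconv_lipschitz (L : R) (dh : 'rV[R]_n -> 'rV[R]_n) a A :
  lipschitz_with L dh -> vconv a A -> vconv (dh \o a) (dh A).
Proof.
move=> Lh aA; apply: (@cvg0_le _ (fun k => L * enorm (a k - A))).
  by move=> k; rewrite enorm_ge0 Lh.
by rewrite -[X in _ --> X](mulr0 L); apply: cvgM => //; exact: cvg_cst.
Qed.

Lemma vconv_loc_lipschitz (S : set 'rV[R]_n) (phi : 'rV[R]_n -> R) a A :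
  loc_lipschitz_on S phi -> S A -> (forall k, S (a k)) -> vconv a A ->
  (phi \o a) @ \oo --> phi A.
Proof.
move=> lphi SA Sa aA; have [d d0 [K KH]] := lphi _ SA; apply/cvgrPdist_lt => e e0.
have K1 : 0 < `|K| + 1 by rewrite ltr_wpDl.
have d'0 : 0 < Num.min d (e / (`|K| + 1)) by rewrite lt_min d0 divr_gt0.
have [N NH] := cvg_eventually aA d'0; exists N => // k Nk /=; rewrite distrC.
have := NH k Nk; rewrite subr0 ger0_norm ?enorm_ge0// lt_min => /andP[kd ke].
apply: le_lt_trans (KH _ _ (Sa k) SA kd _) _; first by rewrite subrr enorm0.
move: ke; rewrite ltr_pdivlMr//; apply: le_lt_trans; rewrite mulrC.
rewrite ler_wpM2l ?enorm_ge0//; apply: le_trans (ler_norm _) _.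
by rewrite lerDl ler01.
Qed.

(** The strict bound k < s k makes [(s k).-1] at least k, which [lsubdiff_cluster] uses to go back
    one iteration. *)
Lemma cluster_pt_subseq x p : cluster_pt x p ->
  exists2 s : nat -> nat, (forall k, (k < s k)%N) & vconv (x \o s) p.
Proof.
move=> xp; have /choice[s sP] : forall k : nat, exists j,
    (k < j)%N /\ enorm (x j - p) < k.+1%:R^-1.
  by move=> k; have [|j ? ?] := xp k.+1%:R^-1 _ k.+1; [rewrite invr_gt0|exists j].
exists s => [k|]; first by have [] := sP k.
apply: (@cvg0_le _ (@harmonic R)); last exact: cvg_harmonic.
by move=> k; rewrite enorm_ge0 /= ltW//; have [] := sP k.
Qed.

(* Once an iterate is close to [p] with [V] small, the telescoping bound keeps
   all later iterates in the ball, so that the bound keeps applying. *)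
Lemma trapped_near_cluster_pt x p (V : nat -> R) (d : R) N :
  0 < d -> cluster_pt x p ->
  (forall k, (N <= k)%N -> 0 <= V k) -> V @ \oo --> 0 ->
  (forall k, (N <= k)%N -> enorm (x k - p) < d ->
     enorm (x k.+1 - x k) <= V k - V k.+1) ->
  vconv x p /\
  exists B : R, forall m, \sum_(0 <= k < m) enorm (x k.+1 - x k) <= B.
Proof.
move=> d0 xp V0 Vcv step.
have key e : 0 < e -> e <= d -> exists K, (N <= K)%N /\ forall j,
    enorm (x (K + j)%N - p) < e /\
    \sum_(0 <= k < K + j) enorm (x k.+1 - x k) + V (K + j)%N <=
    \sum_(0 <= k < K) enorm (x k.+1 - x k) + V K.
  move=> e0 ed; have e2 : 0 < e / 2 by rewrite divr_gt0.
  have [M MP] := cvg_eventually Vcv e2.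
  have [K + Ke] := xp _ e2 (maxn N M); rewrite geq_max => /andP[NK MK].
  have {MP}VK : V K < e / 2.
    by have := MP _ MK; rewrite subr0 ger0_norm ?V0.
  exists K; split=> // j.
  (* The induction needs the stronger invariant that distance plus V stays below e: a step raises
     the distance by at most what V loses. *)
  suff [H1 H2] : enorm (x (K + j)%N - p) + V (K + j)%N < e /\
    \sum_(0 <= k < K + j) enorm (x k.+1 - x k) + V (K + j)%N <=
    \sum_(0 <= k < K) enorm (x k.+1 - x k) + V K.
    split=> //; apply: le_lt_trans H1.
    by rewrite lerDl V0// (leq_trans NK)// leq_addr.
  elim: j => [|j [IH1 IH2]]; first by rewrite addn0; split=> //; lra.
  have NKj : (N <= K + j)%N by rewrite (leq_trans NK)// leq_addr.
  have {}step : enorm (x (K + j).+1 - x (K + j)%N) <= V (K + j)%N - V (K + j).+1.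
    apply: step => //; apply: lt_le_trans ed; apply: le_lt_trans IH1.
    by rewrite lerDl V0.
  rewrite addnS big_nat_recr//=; split; last by lra.
  have := enorm_triangle (x (K + j).+1) (x (K + j)%N) p; lra.
split.
  apply/cvgrPdist_lt => e e0.
  have m0 : 0 < Num.min e d by rewrite lt_min e0.
  have [|K [_ KP]] := key _ m0; first by rewrite ge_min lexx orbT.
  exists K => // k /= Kk; rewrite sub0r normrN ger0_norm ?enorm_ge0//.
  have [+ _] := KP (k - K)%N; rewrite subnKC// lt_min => /andP[//].
(* With the fixed radius d, the index K and hence the bound on the sums no longer depend on m. *)
have [K [NK KP]] := key _ d0 (lexx _).
exists (\sum_(0 <= k < K) enorm (x k.+1 - x k) + V K) => m.
have [_] := KP m; apply: le_trans; rewrite (@big_cat_nat _ _ _ m _ (K + m))//=.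
  rewrite -addrA lerDl addr_ge0 ?V0 ?(leq_trans NK) ?leq_addr//.
  by apply: sumr_ge0 => k _; exact: enorm_ge0.
by rewrite leq_addl.
Qed.

Lemma nneseries_ltoo (u : nat -> R) (B : R) N : (forall k, 0 <= u k) ->
  (forall m, \sum_(N <= k < m) u k <= B) ->
  (\sum_(N <= k <oo) (u k)%:E < +oo)%E.
Proof.
move=> u0 uB; apply: (@le_lt_trans _ _ B%:E); last exact: ltry.
apply: lime_le.
  by apply: is_cvg_nneseries => k _ _; rewrite lee_fin.
by apply: nearW => m; rewrite sumEFin lee_fin.
Qed.

End Sequences.

(** * The PPGA iterates: standing assumptions and the proximal step *)

Section PPGA.
Variables (R : realType) (n : nat).
Variables (f : 'rV[R]_n -> \bar R) (g h : 'rV[R]_n -> R).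
Variables (dg dh : 'rV[R]_n -> 'rV[R]_n) (L : R).
Variables (x : nat -> 'rV[R]_n) (alpha : nat -> R) (alow aup : R).
Let Omega := [set y : 'rV[R]_n | g y != 0].
Let S := Omega `&` dom_fn f.
Let F := Fobj f g h.
Let fr y := fine (f y).
Let C k := Fr f g h (x k).
Let D k := enorm (x k.+1 - x k).

Hypothesis fproper : proper_fn f.
Hypothesis flip : loc_lipschitz_on S fr.
Hypothesis gC1 : loc_lip_C1_on S g dg.
Hypothesis gpos : forall y, S y -> 0 < g y.
Hypothesis L0 : 0 < L.
Hypothesis hgrad : forall y, is_gradient h y (dh y).
Hypothesis hlip : lipschitz_with L dh.
Hypothesis fh_ge0 : forall y, dom_fn f y -> (0%E <= f y + (h y)%:E)%E.
Hypothesis Flsc : lsc_fn F.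
Hypothesis Flev : level_bounded F.
Hypothesis x0S : S (x 0%N).
Hypothesis alow0 : 0 < alow.
Hypothesis aupL : aup < 1 / L.
Hypothesis alphaP : forall k, alow <= alpha k <= aup.
Hypothesis xprox : forall k,
  prox (fun u => ((alpha k)%:E * (f u - (fine (F (x k)) * g u)%:E))%E)
       (x k - alpha k *: dh (x k)) (x k.+1).
Hypothesis FKL :
  forall y, dom_fn F y -> (exists v, lsubdiff F y v) -> KL_at F y.

Let fN y : f y != -oo%E := fproper.1 y.

Lemma f_fin y : dom_fn f y -> f y = (fr y)%:E.
Proof. by rewrite /dom_fn /fr /=; move: (fN y); case: (f y). Qed.

Lemma F_fin y : S y -> F y = (Fr f g h y)%:E.
Proof. by move=> [gy fy]; rewrite /F Fobj_fin. Qed.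

Lemma fin_F y t : (F y <= t%:E)%E -> S y.
Proof. by rewrite /F /Fobj; case: ifPn => [/andP[]|_]; rewrite ?leye_eq. Qed.

Lemma Fr_mul y : S y -> Fr f g h y * g y = fr y + h y.
Proof. by move=> [gy _]; rewrite /Fr divfK. Qed.

Lemma frh_ge0 y : dom_fn f y -> 0 <= fr y + h y.
Proof. by move=> fy; have := fh_ge0 fy; rewrite f_fin// -EFinD lee_fin. Qed.

Lemma Fr_ge0 y : S y -> 0 <= Fr f g h y.
Proof. by move=> Sy; apply: divr_ge0 (frh_ge0 Sy.2) (ltW (gpos Sy)). Qed.

Lemma gradg y : S y -> is_gradient g y (dg y).
Proof.
by move=> Sy; have [d d0 [K [dP _]]] := gC1 Sy; apply: dP; rewrite subrr enorm0.
Qed.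

Lemma alpha_gt0 k : 0 < alpha k.
Proof. by have /andP[ak _] := alphaP k; exact: lt_le_trans ak. Qed.

Lemma aup_gt0 : 0 < aup.
Proof. by have /andP[_] := alphaP 0; apply: lt_le_trans; exact: alpha_gt0. Qed.

(** Expanding the square around the shifted centre produces the linear term in dh(x^k) and a term
    alpha_k^2 |dh(x^k)|^2 common to both sides; division by alpha_k gives this form. *)
Lemma prox_ineq k : S (x k) -> dom_fn f (x k.+1) /\ forall u, dom_fn f u ->
  fr (x k.+1) - C k * g (x k.+1) + dotp (dh (x k)) (x k.+1 - x k) +
    (2 * alpha k)^-1 * D k ^+ 2 <=
  fr u - C k * g u + dotp (dh (x k)) (u - x k) +
    (2 * alpha k)^-1 * enorm (u - x k) ^+ 2.
Proof.
move=> Sk; have a0 := alpha_gt0 k.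
have dy : dom_fn f (x k.+1).
  (* Comparison with the finite value at x^k rules out f = +oo at the new point. *)
  have := xprox k (x k); rewrite (f_fin Sk.2) /dom_fn /=.
  move: (fN (x k.+1)); case: (f _) => [r|//|//] /=; first by rewrite ltry.
  by rewrite addye// gt0_muley ?lte_fin// addye// -EFinB -EFinM -EFinD leye_eq.
split=> // u du; have := xprox k u; rewrite (f_fin dy) (f_fin du) F_fin//=.
rewrite -!EFinB -!EFinM -!EFinD lee_fin.
have E y : enorm (y - (x k - alpha k *: dh (x k))) ^+ 2 =
    enorm (y - x k) ^+ 2 + 2 * alpha k * dotp (dh (x k)) (y - x k) +
    alpha k ^+ 2 * enorm (dh (x k)) ^+ 2.
  rewrite opprB addrCA addrC; move: (y - x k) => z.
  by rewrite !enorm_sqr !dotpE (dotpC (dh _) z); ring.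
rewrite !E -/(C k) => H; rewrite -(ler_pM2l a0).
have K r : alpha k * ((2 * alpha k)^-1 * r) = r / 2 by field; rewrite gt_eqF.
by rewrite !(mulrDr (alpha k)) !K /D; lra.
Qed.

(** The uniform surplus of the proximal coefficient 1 / (2 alpha_k) over the coefficient L / 2 of
    the descent lemma. *)
Let a0 := (1 / aup - L) / 2.

Lemma a0_gt0 : 0 < a0.
Proof.
rewrite divr_gt0// subr_gt0 ltr_pdivlMr ?aup_gt0// mulrC -ltr_pdivlMr//.
Qed.

Lemma a0_le k : a0 <= (2 * alpha k)^-1 - L / 2.
Proof.
rewrite /a0 mulrBl lerD2r mul1r -invfM mulrC lef_pV2 ?posrE ?mulr_gt0//.
- by have /andP[_ ?] := alphaP k; rewrite ler_pM2l.
- exact: aup_gt0.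
- exact: alpha_gt0.
Qed.

(** Testing the proximal inequality at u = x^k and adding the descent lemma bounds f + h at x^(k+1)
    by C_k g(x^(k+1)) - a0 D_k^2. *)
Lemma iter_step k : S (x k) ->
  S (x k.+1) /\ a0 * D k ^+ 2 <= (C k - C k.+1) * g (x k.+1).
Proof.
move=> Sk; have [dy /(_ _ Sk.2)] := prox_ineq Sk.
rewrite subrr dotp0r enorm0 expr0n /= mulr0 !addr0 Fr_mul// => H.
have dec := descent (x k) (x k.+1) hgrad hlip.
have H2 : fr (x k.+1) + h (x k.+1) + a0 * D k ^+ 2 <= C k * g (x k.+1).
  have := ler_wpM2r (sqr_ge0 (D k)) (a0_le k); rewrite mulrBl.
  by move: H dec; rewrite -/(D k); lra.
have Sk1 : S (x k.+1).
  (* If g vanished at x^(k+1), then f + h >= 0 would force D_k = 0, and x^(k+1) = x^k would lie in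
     [Omega]. *)
  split=> //=; apply/eqP => g0; move: H2; rewrite g0 mulr0 => H2.
  have D0 : D k ^+ 2 = 0.
    apply/eqP; rewrite eq_le sqr_ge0 andbT -(ler_pM2l a0_gt0) mulr0.
    by have := frh_ge0 dy; lra.
  move/eqP: D0; rewrite sqrf_eq0 => /eqP /enorm0_eq0 /subr0_eq xE.
  by move: (Sk.1); rewrite /Omega /= -xE g0 eqxx.
by split=> //; rewrite mulrBl (Fr_mul Sk1); lra.
Qed.

Lemma iter_S k : S (x k).
Proof. by elim: k => // k /iter_step []. Qed.

Lemma C_decr k : C k.+1 <= C k.
Proof.
have [_ H] := iter_step (iter_S k); rewrite -subr_ge0.
rewrite -(pmulr_lge0 _ (gpos (iter_S k.+1))); apply: le_trans H.
by rewrite mulr_ge0 ?sqr_ge0 ?ltW ?a0_gt0.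
Qed.

Lemma C_le0 k : C k <= C 0.
Proof. by elim: k => // k; apply: le_trans; exact: C_decr. Qed.

(** * The initial sublevel set of F and the uniform constants on it *)

Let T := [set y | (F y <= (C 0)%:E)%E].

Lemma T_iter k : T (x k).
Proof. by rewrite /T /= F_fin ?lee_fin ?C_le0//; exact: iter_S. Qed.

(** By lower semicontinuity, a value above C_0 at p would persist near p, where some xs k lies. *)
Lemma T_closed xs p : (forall k, T (xs k)) -> cluster_pt xs p -> T p.
Proof.
move=> Txs xsp; rewrite /T /= leNgt; apply/negP => /Flsc [d d0 dH].
have [k _ /dH] := xsp _ d0 0%N; apply/negP; rewrite -leNgt; exact: Txs.
Qed.

Lemma T_bounded : exists M, forall y, T y -> enorm y <= M.
Proof. exact: Flev. Qed.

Lemma T_loc_bounded_above (phi : 'rV[R]_n -> R) :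
  (forall p, T p -> exists2 d : R, 0 < d & exists B : R,
     forall y, T y -> enorm (y - p) < d -> phi y <= B) ->
  exists2 B : R, 0 < B & forall y, T y -> phi y <= B.
Proof.
by have [M TM] := T_bounded; apply: loc_bounded_above TM _; exact: T_closed.
Qed.

Lemma g_bounded : exists2 G : R, 0 < G & forall y, T y -> g y <= G.
Proof.
apply: T_loc_bounded_above => p /fin_F /gradg gp.
have [d d0 dH] := is_gradient_continuous gp ltr01.
exists d => //; exists (g p + 1) => y _ /dH.
by rewrite ltr_norml => /andP[_]; lra.
Qed.

Lemma ginv_bounded : exists2 G : R, 0 < G & forall y, T y -> (g y)^-1 <= G.
Proof.
apply: T_loc_bounded_above => p /fin_F Sp; have gp := gpos Sp.
have g2 : 0 < g p / 2 by rewrite divr_gt0.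
have [d d0 dH] := is_gradient_continuous (gradg Sp) g2.
exists d => //; exists (g p / 2)^-1 => y _ /dH.
rewrite ltr_norml => /andP[H _].
have gy : g p / 2 <= g y by lra.
by rewrite lef_pV2// posrE (lt_le_trans g2).
Qed.

Lemma dg_bounded : exists2 G : R, 0 < G & forall y, T y -> enorm (dg y) <= G.
Proof.
apply: T_loc_bounded_above => p /fin_F Sp.
have [d d0 [K [_ KH]]] := gC1 Sp; exists d => //.
exists (`|K| * d + enorm (dg p)) => y _ yd.
have := KH y p yd; rewrite subrr enorm0 => /(_ d0) H.
rewrite -[dg y](subrK (dg p)); apply: le_trans (enormD _ _) _.
rewrite lerD2r; apply: le_trans H _; apply: le_trans (ler_norm _) _.
by rewrite normrM (ger0_norm (enorm_ge0 _)) ler_wpM2l// ltW.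
Qed.

Lemma sufficient_decrease : exists2 a : R, 0 < a &
  forall k, a * D k ^+ 2 <= C k - C k.+1.
Proof.
have [G G0 GP] := g_bounded; exists (a0 / G); first by rewrite divr_gt0 ?a0_gt0.
move=> k; rewrite mulrAC ler_pdivrMr//.
have [_ H] := iter_step (iter_S k); apply: le_trans H _.
by rewrite ler_wpM2l ?subr_ge0 ?C_decr// GP//; exact: T_iter.
Qed.

(* The term [C k - C k.+1] need not be bounded by a multiple of [D k]: it
   telescopes in the Kurdyka-Lojasiewicz argument. *)
Lemma relative_error : exists b c : R, [/\ 0 < b, 0 < c &
  exists2 w : nat -> 'rV[R]_n, (forall k, fsubdiff F (x k.+1) (w k)) &
    forall k, enorm (w k) <= b * D k + c * (C k - C k.+1)].
Proof.
have [G G0 GP] := ginv_bounded; have [N N0 NP] := dg_bounded.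
have b0 : 0 < alow^-1 + L by rewrite addr_gt0 ?invr_gt0.
exists (G * (alow^-1 + L)), (G * N); split; rewrite ?mulr_gt0//.
(* The gradient at u = x^(k+1) of <dh(x^k), u - x^k> + |u - x^k|^2 / (2 alpha_k). *)
pose v k := (alpha k)^-1 *: (x k.+1 - x k) + dh (x k).
exists (fun k => (g (x k.+1))^-1 *:
  (dh (x k.+1) - v k + (C k - C k.+1) *: dg (x k.+1))) => k.
  have [Sk Sk1] := (iter_S k, iter_S k.+1).
  apply: (@fsubdiff_Fobj _ _ _ _ _ _ _ _ _ _ (2 * alpha k)^-1) => //.
  - exact: Sk1.2.
  - exact: gpos.
  - exact: gradg.
  - by rewrite invr_ge0 mulr_ge0// ltW// alpha_gt0.
  move=> u du; have [_ /(_ _ du)] := prox_ineq Sk; rewrite -/(fr _) -/(fr u) /v /D.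
  (* Recentring the square at x^(k+1): its cross term is the first summand of [v k] paired with u -
     x^(k+1). *)
  have -> : u - x k = (u - x k.+1) + (x k.+1 - x k) by rewrite subrKA.
  move: (u - x k.+1) (x k.+1 - x k) => s z.
  rewrite !enorm_sqr !dotpE (dotpC z s) (dotpC (dh _) s).
  have -> : (alpha k)^-1 = 2 * (2 * alpha k)^-1.
    by field; rewrite gt_eqF// alpha_gt0.
  move: (dotp (dh _) _) (2 * alpha k)^-1 => ? ?; lra.
rewrite enormZ ger0_norm ?invr_ge0 ?(ltW (gpos (iter_S _)))//.
rewrite -!mulrA -mulrDr; apply: ler_pM; rewrite ?enorm_ge0 ?invr_ge0//.
- exact: ltW (gpos (iter_S _)).
- exact: GP (T_iter _).
apply: le_trans (enormD _ _) _; apply: lerD; last first.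
  rewrite enormZ ger0_norm ?subr_ge0 ?C_decr// mulrC.
  by rewrite ler_wpM2r ?subr_ge0 ?C_decr// NP//; exact: T_iter.
rewrite /v opprD addrCA addrC mulrDl.
rewrite addrC; apply: le_trans (enormD _ _) _; apply: lerD; last exact: hlip.
rewrite enormN enormZ ger0_norm; last by rewrite invr_ge0 ltW ?alpha_gt0.
rewrite /D ler_wpM2r ?enorm_ge0//.
by rewrite lef_pV2 ?posrE ?alpha_gt0//; have /andP[] := alphaP k.
Qed.

(** * Limits of the objective values, cluster points and the KL argument *)

Lemma C_cvg : exists2 Cs, C @ \oo --> Cs & forall k, Cs <= C k.
Proof.
have Cn : nonincreasing_seq C by apply/nonincreasing_seqP; exact: C_decr.
have Ccv : cvgn C.
  apply: nonincreasing_is_cvgn => //; exists 0 => _ [k _ <-].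
  exact: Fr_ge0 (iter_S k).
by exists (limn C) => // k; exact: nonincreasing_cvgn_ge.
Qed.

Lemma dC_cvg : (fun k => C k - C k.+1) @ \oo --> 0.
Proof.
have [Cs CCs _] := C_cvg; rewrite -[X in _ --> X](subrr Cs).
by apply: cvgB => //; rewrite (cvg_shiftS C).
Qed.

Lemma D_cvg : D @ \oo --> 0.
Proof.
have [a a_gt0 aP] := sufficient_decrease.
apply: cvg_sqr0 => [k|]; first exact: enorm_ge0.
apply: (@cvg0_le _ _ (fun k => a^-1 * (C k - C k.+1))).
  by move=> k; rewrite sqr_ge0 /= ler_pdivlMl.
rewrite -[X in _ --> X](mulr0 a^-1).
by apply: cvgM; [exact: cvg_cst|exact: dC_cvg].
Qed.

Lemma cluster_exists : exists2 p, cluster_pt x p & T p.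
Proof.
have [M TM] := T_bounded; have [p xp] := bounded_cluster_pt (fun k => TM _ (T_iter k)).
by exists p => //; apply: T_closed xp; exact: T_iter.
Qed.

Lemma fr_cvg (s : nat -> nat) p : S p -> vconv (x \o s) p ->
  (fun k => fr (x (s k))) @ \oo --> fr p.
Proof. by move=> Sp; exact: (vconv_loc_lipschitz flip Sp (fun k => iter_S (s k))). Qed.

(** Lower semicontinuity of F gives one inequality only. Since f is locally Lipschitz on S, the
    identity C_k g(x^k) = f(x^k) + h(x^k) passes to the limit along a subsequence, and g(p) can be
    cancelled. *)
Lemma Fr_cluster p Cs : cluster_pt x p -> S p -> C @ \oo --> Cs ->
  Fr f g h p = Cs.
Proof.
move=> /cluster_pt_subseq [s sk xsp] Sp CCs.
have gp : g p != 0 := Sp.1.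
have Ccv : (C \o s) @ \oo --> Cs.
  by apply: cvg_subseq_ge CCs => k; exact: ltnW.
have gcv := vconv_gradient (gradg Sp) xsp.
have hcv := vconv_gradient (hgrad p) xsp.
apply: (mulIf gp); rewrite Fr_mul//.
have H1 : (fun k => C (s k) * g (x (s k))) @ \oo --> Cs * g p by exact: cvgM.
have H2 : (fun k => fr (x (s k)) + h (x (s k))) @ \oo --> fr p + h p.
  by apply: cvgD hcv; exact: fr_cvg.
rewrite -(cvg_lim _ H1)// -(cvg_lim _ H2)//; congr (lim (_ @ \oo)).
by apply/funext => k; rewrite -Fr_mul//; exact: iter_S.
Qed.

(** Places p in the domain of the limiting subdifferential, where the KL property is available; the
    subgradients w_k tend to 0 with D_k and C_k - C_(k+1). *)
Lemma lsubdiff_cluster p : cluster_pt x p -> S p -> lsubdiff F p 0.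
Proof.
move=> xp Sp; have [s sk xsp] := cluster_pt_subseq xp.
have [Cs CCs _] := C_cvg.
have [b [c [b0 c0 [w wF wle]]]] := relative_error.
have w0 : (fun k => enorm (w k)) @ \oo --> 0.
  apply: (@cvg0_le _ _ (fun k => b * D k + c * (C k - C k.+1))).
    by move=> k; rewrite enorm_ge0 wle.
  rewrite (_ : 0 = b * 0 + c * 0); last by rewrite !mulr0 addr0.
  by apply: cvgD; apply: cvgM; try exact: cvg_cst; [exact: D_cvg|exact: dC_cvg].
(* Since w_j is a subgradient at x^(j+1), the point x^(s k) is paired with the preceding index. *)
exists (x \o s), (fun k => w (s k).-1); split => //.
- rewrite F_fin// (Fr_cluster xp Sp CCs).
  rewrite (_ : (fun k => _) = EFin \o (C \o s)); last first.
    by apply/funext => k /=; rewrite F_fin//; exact: iter_S.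
  apply: cvg_EFin; first exact: nearW.
  by apply: cvg_subseq_ge CCs => k; exact: ltnW.
- by move=> k /=; have := wF (s k).-1; rewrite prednK// (leq_trans _ (sk k)).
- rewrite /vconv (_ : (fun k => _) = (fun k => enorm (w k)) \o (fun k => (s k).-1)).
    by apply: cvg_subseq_ge w0 => k; rewrite -ltnS prednK// (leq_trans _ (sk k)).
  by apply/funext => k /=; rewrite subr0.
Qed.

(** The subgradient w bounds the distance in the KL inequality, so 1 <= psi' |w|; concavity bounds
    psi' (C_k - C_(k+1)) by the drop of psi. Combining the two gives the last bound. *)
Lemma KL_decrease (eta : \bar R) psi p Cs w k : S p -> Fr f g h p = Cs ->
  desing eta psi -> Cs < C k -> Cs <= C k.+1 <= C k -> ((C k - Cs)%:E < eta)%E ->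
  (1 <= (derive1 psi (fine (F (x k) - F p)))%:E * dist0_subdiff F (x k))%E ->
  fsubdiff F (x k) w ->
  0 <= psi (C k - Cs) - psi (C k.+1 - Cs) /\
  C k - C k.+1 <= enorm w * (psi (C k - Cs) - psi (C k.+1 - Cs)).
Proof.
move=> Sp Fp [_ psiconc _ psidiff psi'] CsC /andP[CsC' C'C] Ceta + wF.
rewrite (F_fin (iter_S k)) (F_fin Sp) Fp -EFinB /= -/(C k) => KL.
have t0 : 0 < C k - Cs by rewrite subr_gt0.
have p0 := psi' _ (conj t0 Ceta).
have wp : 1 <= derive1 psi (C k - Cs) * enorm w.
  rewrite -lee_fin EFinM; apply: le_trans KL _.
  rewrite lee_pmul2l// ?lte_fin//; apply: ereal_inf_lbound; exists w => //.
  (* Constant sequences show that a Frechet subgradient is a limiting one. *)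
  exists (fun=> x k), (fun=> w); split => //; last exact: vconv_cst.
    exact: vconv_cst.
  exact: cvg_cst.
have slope : derive1 psi (C k - Cs) * (C k - C k.+1) <=
    psi (C k - Cs) - psi (C k.+1 - Cs).
  rewrite [C k - C k.+1](_ : _ = (C k - Cs) - (C k.+1 - Cs)); last by ring.
  apply: concave_slope; first by have [] := psidiff _ (conj t0 Ceta).
  have I1 : 0 <= C k.+1 - Cs /\ ((C k.+1 - Cs)%:E < eta)%E.
    split; first by rewrite subr_ge0.
    by apply: le_lt_trans Ceta; rewrite lee_fin lerD2r.
  by move=> a a01; apply: psiconc => //; exact: conj (ltW t0) Ceta.
have dC : 0 <= C k - C k.+1 by rewrite subr_ge0.
split; first by apply: le_trans slope; rewrite mulr_ge0// ltW.
apply: le_trans (ler_wpM2l (enorm_ge0 w) slope).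
by rewrite mulrA (mulrC (enorm w)) ler_peMl.
Qed.

(** Continuity of [psi] is relative to [0, eta), so the limit at 0 is taken within that interval,
    where all t k lie. *)
Lemma desing_cvg0 (eta : \bar R) psi (t : nat -> R) : (0 < eta)%E -> desing eta psi ->
  (forall k, 0 <= t k /\ ((t k)%:E < eta)%E) -> t @ \oo --> 0 ->
  (psi \o t) @ \oo --> 0.
Proof.
move=> eta0 [/subspace_continuousP psic _ [_ psi0] _ _] tI t0.
have I0 : [set t : R | 0 <= t /\ (t%:E < eta)%E] 0 by [].
have psic0 : psi @ within [set t : R | 0 <= t /\ (t%:E < eta)%E] (nbhs (0 : R)) --> (0 : R).
  by rewrite -[X in _ --> X]psi0; exact: psic.
apply: cvg_comp psic0 => A [e /= e0 eA].
have [N NP] := cvg_eventually t0 e0; exists N => // k Nk.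
by apply: eA (tI k); rewrite /= distrC; exact: NP.
Qed.

Lemma iter_converges : exists p, [/\ S p, vconv x p, Fr f g h p = limn C &
  exists B : R, forall m, \sum_(0 <= k < m) D k <= B].
Proof.
have [p xp /fin_F Sp] := cluster_exists; exists p.
have [Cs CCs CsC] := C_cvg; have Fp := Fr_cluster xp Sp CCs.
rewrite (cvg_lim _ CCs)//.
suff [xcv HB] : vconv x p /\ exists B : R, forall m, \sum_(0 <= k < m) D k <= B by [].
have [a a_gt0 aP] := sufficient_decrease.
(* If the values reach their limit, sufficient decrease makes all later steps vanish; otherwise C_k
   > Cs throughout, as the KL inequality demands. *)
have [[K CK]|CCs_lt] := pselect (exists K, C K = Cs).
  have CE k : (K <= k)%N -> C k = Cs.
    move=> Kk; apply/eqP; rewrite eq_le CsC andbT -CK.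
    by apply: (nonincreasing_seqP C).1 Kk => j; exact: C_decr.
  apply: (@trapped_near_cluster_pt _ _ _ _ (fun=> 0) 1 K) => //.
    exact: cvg_cst.
  move=> k Kk _; rewrite subrr; have := aP k; rewrite !CE ?leqW// subrr.
  rewrite pmulr_rle0// => D0.
  by rewrite -/(D k) -(@ler_pXn2r _ 2)// ?nnegrE ?enorm_ge0// expr0n.
have {}CCs_lt k : Cs < C k.
  rewrite lt_neqAle CsC andbT; apply/eqP => CE; apply: CCs_lt.
  by exists k.
have [_ [eta [eta0 [d d0 [psi [dpsi psiKL]]]]]] : KL_at F p.
  apply: FKL; first by rewrite /dom_fn /= F_fin// ltry.
  by exists 0; exact: lsubdiff_cluster.
have [b [c [b0 c0 [w wF wle]]]] := relative_error.
have tcv : (fun k => C k - Cs) @ \oo --> 0.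
  by rewrite -[X in _ --> X](subrr Cs); apply: cvgB CCs _; exact: cvg_cst.
have [N NP] : exists N, forall k, (N <= k)%N -> ((C k - Cs)%:E < eta)%E.
  case: eta eta0 {dpsi psiKL} => [r|_|//]; last by exists 0%N => k _; rewrite ltry.
  rewrite lte_fin => r0; have [N NP] := cvg_eventually tcv r0.
  exists N => k /NP; rewrite subr0 lte_fin; apply: le_lt_trans; exact: ler_norm.
(* The shift by N keeps every t k below eta; the successor appears because w_m, with m = N + k, is a
   subgradient at x^(m+1). *)
pose y k := x (N + k).+1.
pose t k := C (N + k) - Cs.
have tN k : 0 <= t k /\ ((t k)%:E < eta)%E.
  by rewrite subr_ge0 CsC NP ?leq_addr.
have t0 : t @ \oo --> 0.
  exact: (cvg_subseq_ge (fun k => leq_addl N k)) tcv.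
pose V k := D (N + k)%N + c / b * t k + b / a * psi (t k.+1).
have yp : cluster_pt y p.
  move=> e e0 M; have [k Mk ke] := xp e e0 (N + M).+1.
  exists (k - N.+1)%N; first by rewrite leq_subRL ?addSn// (leq_trans _ Mk)// ltnS leq_addr.
  by rewrite /y -addSn subnKC// (leq_trans _ Mk)// ltnS leq_addr.
have [yE [B BP]] : vconv y p /\ exists B : R, forall m,
    \sum_(0 <= k < m) enorm (y k.+1 - y k) <= B.
  apply: (@trapped_near_cluster_pt _ _ _ _ V d 0) => //.
  - move=> k _; have [tk _] := tN k.
    have psik : 0 <= psi (t k.+1) by have [_ _ [+ _] _ _] := dpsi; apply; exact: tN.
    have [cb ba] := (divr_ge0 (ltW c0) (ltW b0), divr_ge0 (ltW b0) (ltW a_gt0)).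
    by rewrite !addr_ge0 ?enorm_ge0// mulr_ge0.
  - rewrite [X in _ --> X](_ : 0 = 0 + c / b * 0 + b / a * 0); last by ring.
    apply: cvgD; first apply: cvgD.
    + exact: (cvg_subseq_ge (fun k => leq_addl N k)) D_cvg.
    + by apply: cvgM t0; exact: cvg_cst.
    + apply: cvgM; first exact: cvg_cst.
      have := desing_cvg0 eta0 dpsi tN t0.
      exact: (cvg_subseq_ge leqnSn).
  move=> k _ yd; rewrite /y -/(D _) /V !addnS.
  set m := (N + k)%N.
  have tm1 : t k.+1 = C m.+1 - Cs by rewrite /t addnS.
  have tm2 : t k.+2 = C m.+2 - Cs by rewrite /t !addnS.
  have [psid KL] : 0 <= psi (C m.+1 - Cs) - psi (C m.+2 - Cs) /\
      C m.+1 - C m.+2 <= enorm (w m) * (psi (C m.+1 - Cs) - psi (C m.+2 - Cs)).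
    apply: (KL_decrease Sp Fp dpsi) => //.
    - by rewrite CsC C_decr.
    - by apply: NP; rewrite leqW// leq_addr.
    - apply: psiKL => //; rewrite (F_fin (iter_S _)) (F_fin Sp) Fp ?lte_fin//.
        exact: CCs_lt.
      have := NP m.+1; rewrite leqW ?leq_addr// => /(_ isT).
      by rewrite EFinB lteBlDl.
  rewrite tm1 tm2 [t k]/t -/m.
  (* The bound on |w_m| divided by b, so that D_(m+1)^2 is at most X times b / a times the drop of
     psi. *)
  pose X := D m + c / b * (C m - C m.+1).
  have XE : enorm (w m) <= b * X.
    apply: le_trans (wle m) _; rewrite le_eqVlt; apply/orP; left; apply/eqP.
    by rewrite /X; field; rewrite gt_eqF.
  have X0 : 0 <= X by rewrite -(pmulr_rge0 _ b0) (le_trans (enorm_ge0 _) XE).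
  have := @amgm_sqr _ X (b / a * (psi (C m.+1 - Cs) - psi (C m.+2 - Cs))) (D m.+1) X0.
  rewrite mulr_ge0 ?divr_ge0 ?(ltW b0) ?(ltW a_gt0)// => /(_ isT) H.
  have {}H : 2 * D m.+1 <= X + b / a * (psi (C m.+1 - Cs) - psi (C m.+2 - Cs)).
    apply: H; rewrite -(ler_pM2l a_gt0); apply: le_trans (aP m.+1) _.
    apply: le_trans KL _; apply: le_trans (ler_wpM2r psid XE) _.
    rewrite le_eqVlt; apply/orP; left; apply/eqP.
    by field; rewrite gt_eqF.
  (* Subtracting D_(m+1) from both sides leaves exactly V k - V k.+1 on the right. *)
  by move: H; rewrite /X -/(D m.+1); lra.
have yN k : y k = x (k + N.+1)%N by rewrite /y addnS addnC.
split.
  rewrite /vconv -(@cvg_shiftn N.+1); move: yE; rewrite /vconv.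
  by under eq_fun do rewrite yN.
(* The first N + 1 steps precede the sequence y and are added to its bound. *)
exists (\sum_(0 <= k < N.+1) D k + B) => m.
apply: (@le_trans _ _ (\sum_(0 <= k < m + N.+1) D k)).
  rewrite (@big_cat_nat _ _ _ m _ (m + N.+1))//= ?leq_addr// lerDl.
  by apply: sumr_ge0 => k _; exact: enorm_ge0.
rewrite (@big_cat_nat _ _ _ N.+1)//= ?leq_addl// lerD2l.
rewrite -{1}[N.+1]add0n big_addn addnK; apply: le_trans (BP m).
by apply: ler_sum => k _; rewrite !yN addSn.
Qed.

(* Limiting subgradients do not suffice here, so stationarity is read off by
   passing to the limit in the proximal inequality, with step size [alow]. *)
Lemma limit_stationary p : S p -> vconv x p -> Fr f g h p = limn C ->
  stationary F p.
Proof.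
move=> Sp xp FpC; have [Cs CCs _] := C_cvg.
have {}FpC : Fr f g h p = Cs by rewrite FpC (cvg_lim _ CCs).
have xp1 : vconv (x \o succn) p.
  exact: (cvg_subseq_ge leqnSn xp).
have frcv := fr_cvg (s := succn) Sp xp1.
have gcv := vconv_gradient (gradg Sp) xp1.
have dhcv := vconv_lipschitz hlip xp.
have tau0 : 0 <= (2 * alow)^-1 by rewrite invr_ge0 mulr_ge0// ltW.
rewrite /stationary.
(* Zero is written as the quotient-rule subgradient with v = dh p and C = F(p). *)
have -> : (0 : 'rV[R]_n) = (g p)^-1 *: (dh p - dh p + (Cs - Fr f g h p) *: dg p).
  by rewrite FpC !subrr scale0r addr0 scaler0.
apply: (@fsubdiff_Fobj _ _ _ _ _ _ _ _ _ _ (2 * alow)^-1) => //.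
- exact: Sp.2.
- exact: gpos.
- exact: gradg.
move=> u du; rewrite -/(fr p) -/(fr u).
have lhs : (fun k => fr (x k.+1) - C k * g (x k.+1) +
    dotp (dh (x k)) (x k.+1 - x k)) @ \oo --> fr p - Cs * g p + dotp (dh p) (p - p).
  apply: cvgD; last exact: vconv_dotp dhcv (vconvB xp1 xp).
  by apply: cvgB frcv _; exact: cvgM.
have uxcv : vconv (fun k => u - x k) (u - p) by exact: vconvB (vconv_cst u) xp.
have rhs : (fun k => fr u - C k * g u + dotp (dh (x k)) (u - x k) +
    (2 * alow)^-1 * dotp (u - x k) (u - x k)) @ \oo -->
    fr u - Cs * g u + dotp (dh p) (u - p) + (2 * alow)^-1 * dotp (u - p) (u - p).
  apply: cvgD; last by apply: cvgM; [exact: cvg_cst|exact: vconv_dotp].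
  apply: cvgD; last exact: vconv_dotp.
  by apply: cvgB; [exact: cvg_cst|apply: cvgM => //; exact: cvg_cst].
rewrite enorm_sqr -[leLHS]addr0 -(dotp0r (dh p)) -(subrr p).
apply: (ler_cvg_to lhs rhs); apply: nearW => k.
have [_ /(_ _ du)] := prox_ineq (iter_S k).
(* The alpha_k may fail to converge; enlarging the quadratic coefficient to its value at [alow]
   yields a right-hand side that has a limit. *)
have : (2 * alpha k)^-1 * enorm (u - x k) ^+ 2 <= (2 * alow)^-1 * dotp (u - x k) (u - x k).
  rewrite enorm_sqr ler_wpM2r ?dotp_ge0//.
  rewrite lef_pV2 ?posrE ?mulr_gt0 ?alpha_gt0//.
  by rewrite ler_pM2l//; have /andP[] := alphaP k.
have : 0 <= (2 * alpha k)^-1 * D k ^+ 2.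
  by rewrite mulr_ge0 ?sqr_ge0// invr_ge0 mulr_ge0// ltW ?alpha_gt0.
lra.
Qed.

End PPGA.

Theorem mainTheorem12 (R : realType) (n : nat)
  (f : 'rV[R]_n -> \bar R) (g h : 'rV[R]_n -> R)
  (dg dh : 'rV[R]_n -> 'rV[R]_n) (L : R)
  (x : nat -> 'rV[R]_n) (alpha : nat -> R) (alow aup : R) :
  let Omega := [set y : 'rV[R]_n | g y != 0] in
  let F := Fobj f g h in
  (* f proper and lsc *)
  proper_fn f -> lsc_fn f ->
  (* Assumption 1 (i) *)
  loc_lipschitz_on (Omega `&` dom_fn f) (fun y => fine (f y)) ->
  (* Assumption 1 (ii) *)
  loc_lip_C1_on (Omega `&` dom_fn f) g dg ->
  (forall y, (Omega `&` dom_fn f) y -> 0 < g y) ->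
  (* Assumption 1 (iii) *)
  0 < L -> (forall y, is_gradient h y (dh y)) -> lipschitz_with L dh ->
  (* Assumption 1 (iv) *)
  (forall y, dom_fn f y -> (0%E <= f y + (h y)%:E)%E) ->
  (Omega `&` dom_fn f) !=set0 ->
  (* Assumption 1 (v) *)
  (forall (y : 'rV[R]_n) (gam : R), 0 <= gam ->
     prox (fun u => (f u - (gam * g u)%:E)%E) y !=set0) ->
  (* Assumption 1 (vi) *)
  lsc_fn F -> level_bounded F ->
  (* PPGA *)
  (Omega `&` dom_fn f) (x 0%N) ->
  0 < alow -> aup < 1 / L -> (forall k, alow <= alpha k <= aup) ->
  (forall k, prox (fun u => ((alpha k)%:E * (f u - (fine (F (x k)) * g u)%:E))%E)
                  (x k - alpha k *: dh (x k)) (x k.+1)) ->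
  (* KL property of F at the points of dom F (that lie in dom of the limiting subdifferential) *)
  (forall y, dom_fn F y -> (exists v, lsubdiff F y v) -> KL_at F y) ->
  ((\sum_(1 <= k <oo) (enorm (x k - x k.-1))%:E) < +oo)%E /\
  exists2 xstar, vconv x xstar & stationary F xstar.
Proof.
move=> Omega F fproper _ flip gC1 gpos L0 hgrad hlip fh_ge0 _ _ Flsc Flev x0S.
move=> alow0 aupL alphaP xprox FKL.
have [p [Sp xp Fp [B BP]]] := iter_converges fproper flip gC1 gpos L0 hgrad hlip
  fh_ge0 Flsc Flev x0S alow0 aupL alphaP xprox FKL.
split; last first.
  exists p => //; exact: (limit_stationary fproper flip gC1 gpos L0 hgrad hlip
    fh_ge0 x0S alow0 aupL alphaP xprox Sp xp Fp).
apply: (@nneseries_ltoo _ (fun k => enorm (x k - x k.-1)) B) => [k|m].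
  exact: enorm_ge0.
by rewrite big_add1; exact: BP.
Qed.
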